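(* Let $(L,\leqslant)$ be an infinite linearly ordered set and $n$ a natural number. Then the following hold in the semigroup $\mathscr{OI}_n(L)$ of partial order isomorphisms of $L$ of rank at most $n$, for $\alpha,\beta\in\mathscr{OI}_n(L)$. (1) A nonzero element $\alpha$ of $\mathscr{OI}_n(L)$ is an idempotent if and only if $\alpha$ is a partial identity map (i.e. $(x)\alpha=x$ for all $x\in\operatorname{dom}\alpha$). (2) $\alpha\preccurlyeq\beta$ in $\mathscr{OI}_n(L)$ if and only if $\alpha\subseteq\beta$. (3) $\alpha\mathscr{R}\beta$ in $\mathscr{OI}_n(L)$ if and only if $\operatorname{dom}\alpha=\operatorname{dom}\beta$. (4) $\alpha\mathscr{L}\beta$ in $\mathscr{OI}_n(L)$ if and only if $\operatorname{ran}\alpha=\operatorname{ran}\beta$. (5) $\alpha\mathscr{H}\beta$ in $\mathscr{OI}_n(L)$ if and only if $\alpha=\beta$. (6) $\alpha\mathscr{D}\beta$ in $\mathscr{OI}_n(L)$ if and only if $|\operatorname{dom}\alpha|=|\operatorname{dom}\beta|$. (7) $\mathscr{D}=\mathscr{J}$ in $\mathscr{OI}_n(L)$.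
   Context: Natural numbers are positive integers. A partial order isomorphism of a linearly ordered set $(L,\leqslant)$ is an injective partial map $\alpha\colon L\rightharpoonup L$ with domain $\operatorname{dom}\alpha$ and range $\operatorname{ran}\alpha$ such that for all $x_1,x_2\in\operatorname{dom}\alpha$, $x_1\leqslant x_2$ implies $(x_1)\alpha\leqslant(x_2)\alpha$ (the empty partial map $\boldsymbol{0}$ is allowed). Maps are written on the right and composed from left to right: $(x)(\alpha\beta)=((x)\alpha)\beta$, with $\operatorname{dom}(\alpha\beta)=\{y\in\operatorname{dom}\alpha : (y)\alpha\in\operatorname{dom}\beta\}$. For a natural number $n$, $\mathscr{OI}_n(L)$ is the semigroup, under this composition, of all partial order isomorphisms $\alpha$ of $L$ with $|\operatorname{dom}\alpha|\leq n$. It is an inverse semigroup, and $\boldsymbol{0}$ is its zero. The natural partial order on an inverse semigroup $S$ is: $s\preccurlyeq t$ if and only if $s=te$ for some idempotent $e\in S$. For partial maps, $\alpha\subseteq\beta$ means $\operatorname{dom}\alpha\subseteq\operatorname{dom}\beta$ and $(x)\beta=(x)\alpha$ for all $x\in\operatorname{dom}\alpha$. Green's relations on a semigroup $S$ (with $S^1$ denoting $S$ with an identity adjoined if necessary): $a\mathscr{R}b$ iff $aS^1=bS^1$; $a\mathscr{L}b$ iff $S^1a=S^1b$; $a\mathscr{J}b$ iff $S^1aS^1=S^1bS^1$; $\mathscr{D}=\mathscr{L}\circ\mathscr{R}=\mathscr{R}\circ\mathscr{L}$; $\mathscr{H}=\mathscr{L}\cap\mathscr{R}$. *)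

(* Defs.v *)
From HB Require Import structures.
From mathcomp Require Import all_boot all_order finmap.
From mathcomp Require Import boolp classical_sets cardinality.

Set Implicit Arguments.
Unset Strict Implicit.
Unset Printing Implicit Defensive.

Import Order.TTheory.

Local Open Scope fset_scope.
Local Open Scope fmap_scope.
Local Open Scope classical_set_scope.
Local Open Scope group_scope.

Section Semigroups.
Variable S : semigroupType.
Implicit Types (a b s t e : S) (u v : option S).

(* [option S] plays the role of S^1, with [None] the adjoined identity. If S
   already has an identity, adjoining another one does not change the sets
   a S^1, S^1 a and S^1 a S^1. *)
Definition mulS1 a u : S := if u is Some s then a * s else a.
Definition S1mul u a : S := if u is Some s then s * a else a.

Definition right_ideal a : set S := [set mulS1 a u | u in [set: option S]].
Definition left_ideal a : set S := [set S1mul u a | u in [set: option S]].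
Definition two_sided_ideal a : set S :=
  [set S1mul u (mulS1 a v) | u in [set: option S] & v in [set: option S]].

Definition greenR a b : Prop := right_ideal a = right_ideal b.
Definition greenL a b : Prop := left_ideal a = left_ideal b.
Definition greenJ a b : Prop := two_sided_ideal a = two_sided_ideal b.
Definition greenH a b : Prop := greenL a b /\ greenR a b.
Definition greenD a b : Prop := exists s, greenL a s /\ greenR s b.

Definition idempotent_elt e : Prop := e * e = e.

Definition natural_le s t : Prop := exists e, idempotent_elt e /\ s = t * e.

End Semigroups.

Section PartialMaps.
Variables (d : Order.disp_t) (L : orderType d).
Implicit Types f g : {fmap L -> L}.

(* Left-to-right composition: x is sent to g (f x), and the domain consists of
   the x in [domf f] with f x in [domf g]. *)
Definition comp_fmap f g : {fmap L -> L} := reducef [fmap x : domf f => g.[? f x]].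

Lemma fnd_comp_fmap f g x : (comp_fmap f g).[? x] = obind (fun y => g.[? y]) f.[? x].
Proof.
rewrite /comp_fmap fnd_reducef; case: (fndP f) => [xf|xNf].
  by rewrite in_fnd /= ffunE.
by rewrite not_fnd.
Qed.

Lemma domf_comp_fmap f g x :
  (x \in domf (comp_fmap f g)) = if f.[? x] is Some y then y \in domf g else false.
Proof. by rewrite -fndSome fnd_comp_fmap; case: f.[? x] => //= y; rewrite fndSome. Qed.

Definition order_iso f : bool :=
  injectiveb f &&
  [forall x : domf f, forall y : domf f,
     (val x <= val y)%O ==> (f x <= f y)%O].

Lemma order_isoP f :
  reflect
    ((forall x y z, f.[? x] = Some z -> f.[? y] = Some z -> x = y) /\
     (forall x y x' y', f.[? x] = Some x' -> f.[? y] = Some y' ->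
        (x <= y)%O -> (x' <= y')%O))
    (order_iso f).
Proof.
apply: (iffP andP) => -[inj_f mon_f]; split.
- move=> x y z; case: fndP => // xf [fx]; case: fndP => // yf [fy].
  by have /(congr1 val) := injectiveP _ inj_f [` xf] [` yf] (etrans fx (esym fy)).
- move=> x y x' y'; case: fndP => // xf [<-]; case: fndP => // yf [<-] le_xy.
  by have /forallP/(_ [` yf])/implyP/(_ le_xy) := forallP mon_f [` xf].
- apply/injectiveP => x y fxy; apply: val_inj.
  by apply: (inj_f _ _ (f y)); rewrite -Some_fnd //; congr Some.
- apply/forallP => x; apply/forallP => y; apply/implyP.
  by apply: mon_f; rewrite -Some_fnd.
Qed.

Definition psub f g : Prop :=
  (domf f `<=` domf g)%fset /\ (forall x, x \in domf f -> g.[? x] = f.[? x]).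

Definition partial_id f : Prop := forall x : domf f, f x = val x.

End PartialMaps.

Section OI.
Variables (d : Order.disp_t) (L : orderType d) (n : nat).

Definition in_OI (f : {fmap L -> L}) : bool :=
  order_iso f && (#|` domf f| <= n)%N.

Record OI := MkOI { OI_fmap :> {fmap L -> L}; _ : in_OI OI_fmap }.

HB.instance Definition _ := [isSub for OI_fmap].
HB.instance Definition _ := [Equality of OI by <:].
HB.instance Definition _ := [Choice of OI by <:].

(* [{fmap L -> L}] and [finMap L L] are convertible but distinct coercion
   classes; this second coercion allows [domf a], [codomf a] and [a.[? x]]. *)
Coercion finMap_of_OI (a : OI) : finMap L L := OI_fmap a.

Lemma comp_fmap_in_OI (a b : OI) : in_OI (comp_fmap a b).
Proof.
case: a b => [a /andP[/order_isoP[ia ma] ca]] [b /andP[/order_isoP[ib mb] cb]] /=.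
apply/andP; split.
  apply/order_isoP; split=> [x y z|x y x' y']; rewrite !fnd_comp_fmap.
    case ax: a.[? x] => [u|//]; case ay: a.[? y] => [v|//] /= bu bv.
    by rewrite -(ib _ _ _ bu bv) in ay; apply: ia ax ay.
  case ax: a.[? x] => [u|//]; case ay: a.[? y] => [v|//] /= bu bv le_xy.
  by apply: mb bu bv _; apply: ma ax ay le_xy.
apply: leq_trans ca; apply/fsubset_leq_card/fsubsetP => x.
by rewrite domf_comp_fmap -(fndSome a); case: a.[? x].
Qed.

Definition OI_mul (a b : OI) : OI := MkOI (comp_fmap_in_OI a b).

Lemma OI_mulA : associative OI_mul.
Proof.
move=> a b c; apply/val_inj/fmapP => x /=.
by rewrite !fnd_comp_fmap; case: a.[? x] => //= y; rewrite fnd_comp_fmap.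
Qed.

HB.instance Definition _ := isSemigroup.Build OI OI_mulA.

Lemma fmap0_in_OI : in_OI [fmap].
Proof.
apply/andP; split; last by rewrite cardfs0.
by apply/order_isoP; split=> [x y z|x y x' y']; rewrite fnd_fmap0.
Qed.

Definition OI0 : OI := MkOI fmap0_in_OI.

End OI.

Arguments OI {d} L n.
Arguments OI0 {d L n}.

(* Main.v *)
Require Import Defs.
From mathcomp Require Import all_boot all_order finmap.
From mathcomp Require Import boolp classical_sets cardinality.

Local Open Scope fset_scope.
Local Open Scope classical_set_scope.

Set Implicit Arguments.
Unset Strict Implicit.
Unset Printing Implicit Defensive.

Import Order.TTheory.

(** A partial order isomorphism with finite domain is determined by its domain
    and its range: it matches their increasing enumerations ([map_iso_sort],
    [OI_eq]).  Conversely any two finite sets of the same cardinality at most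
    [n] are the domain and the range of an element ([OI_exists]).  So the
    elements amount to the pairs (A, B) with |A| = |B| <= n, and whenever the
    range of [a] is the domain of [b], the product is the pair
    (dom a, ran b) ([OI_mul_eq]): (A, B)(B, C) = (A, C).

    Products shrink the domain of the left factor and the range of the right
    factor, which gives the necessary conditions for R, L and J; the
    multiplication rule supplies the multipliers for the converses.  The pair
    (dom b, ran a) links [a] to [b] through L and R, and it exists exactly when
    the two ranks agree, so D compares ranks.  D is contained in J in every
    semigroup ([greenD_J]), and here J cannot be coarser because it too
    preserves the rank ([two_sided_ideal_card]).  Idempotents and the natural
    order are computed pointwise, using injectivity. *)

(** * Ideals of a semigroup *)

Section Ideals.
Variable S : semigroupType.
Implicit Types a b : S.

Lemma left_ideal_refl a : left_ideal a a.
Proof. by exists None. Qed.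

Lemma right_ideal_refl a : right_ideal a a.
Proof. by exists None. Qed.

Lemma two_sided_ideal_refl a : two_sided_ideal a a.
Proof. by exists None => //; exists None. Qed.

(** The product of S^1, on the encoding of S^1 as [option S]. *)
Definition mulo (u v : option S) : option S :=
  if u is Some s then Some (mulS1 s v) else v.

Lemma left_ideal_sub a b : left_ideal b a -> left_ideal a `<=` left_ideal b.
Proof.
move=> [u _ <-] _ [x _ <-]; exists (mulo x u) => //.
by case: x u => [x|] [u|] //=; rewrite ?mulgA.
Qed.

Lemma right_ideal_sub a b : right_ideal b a -> right_ideal a `<=` right_ideal b.
Proof.
move=> [v _ <-] _ [y _ <-]; exists (mulo v y) => //.
by case: v y => [v|] [y|] //=; rewrite ?mulgA.
Qed.

Lemma two_sided_ideal_sub a b :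
  two_sided_ideal b a -> two_sided_ideal a `<=` two_sided_ideal b.
Proof.
move=> [u _ [v _ <-]] _ [x _ [y _ <-]].
exists (mulo x u) => //; exists (mulo v y) => //.
by case: x u v y => [x|] [u|] [v|] [y|] //=; rewrite ?mulgA.
Qed.

Lemma greenL_mem a b : greenL a b <-> left_ideal b a /\ left_ideal a b.
Proof.
split=> [Lab|[ba ab]]; last by apply/seteqP; split; apply: left_ideal_sub.
by split; [rewrite -Lab|rewrite Lab]; apply: left_ideal_refl.
Qed.

Lemma greenR_mem a b : greenR a b <-> right_ideal b a /\ right_ideal a b.
Proof.
split=> [Rab|[ba ab]]; last by apply/seteqP; split; apply: right_ideal_sub.
by split; [rewrite -Rab|rewrite Rab]; apply: right_ideal_refl.
Qed.

Lemma greenJ_mem a b : greenJ a b <-> two_sided_ideal b a /\ two_sided_ideal a b.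
Proof.
split=> [Jab|[ba ab]]; last by apply/seteqP; split; apply: two_sided_ideal_sub.
by split; [rewrite -Jab|rewrite Jab]; apply: two_sided_ideal_refl.
Qed.

Lemma greenL_J a b : greenL a b -> greenJ a b.
Proof.
move=> /greenL_mem[[u _ ba] [v _ ab]]; apply/greenJ_mem.
by split; [exists u|exists v] => //; exists None.
Qed.

Lemma greenR_J a b : greenR a b -> greenJ a b.
Proof.
move=> /greenR_mem[[u _ ba] [v _ ab]]; apply/greenJ_mem.
by split; exists None => //; [exists u|exists v].
Qed.

Lemma greenD_J a b : greenD a b -> greenJ a b.
Proof. by move=> [s [/greenL_J Jas /greenR_J Jsb]]; apply: etrans Jas Jsb. Qed.

End Ideals.

(** * Order isomorphisms between finite sets *)

Section FiniteChains.
Variables (d : Order.disp_t) (L : orderType d).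
Implicit Types (f g : {fmap L -> L}) (A B : {fset L}).

Definition inc_seq A : seq L := sort <=%O (enum_fset A).

Lemma mem_inc_seq A x : (x \in inc_seq A) = (x \in A).
Proof. by rewrite mem_sort. Qed.

Lemma size_inc_seq A : size (inc_seq A) = #|` A|.
Proof. by rewrite size_sort. Qed.

Lemma inc_seq_sorted A : sorted <%O (inc_seq A).
Proof. by rewrite sort_lt_sorted fset_uniq. Qed.

(** A total function that agrees with [f] on its domain, so that it can be
    mapped over the enumeration of that domain. *)
Definition total_ext f x : L := odflt x f.[? x]%fmap.

Lemma fnd_total_ext f x : x \in domf f -> f.[? x]%fmap = Some (total_ext f x).
Proof. by move=> xf; rewrite /total_ext in_fnd. Qed.

(** Both sides are strictly increasing with the same elements: a monotone
    injective map is strictly monotone. *)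
Lemma map_iso_sort f :
  order_iso f -> map (total_ext f) (inc_seq (domf f)) = inc_seq (codomf f).
Proof.
move=> /order_isoP[inj_f mon_f]; apply: lt_sorted_eq.
- apply: (homo_sorted_in (P := mem (domf f))) (inc_seq_sorted _).
    move=> x y xf yf /= lt_xy.
    have fx := fnd_total_ext xf; have fy := fnd_total_ext yf.
    rewrite lt_neqAle (mon_f _ _ _ _ fx fy (ltW lt_xy)) andbT.
    apply: contraTneq lt_xy => fxy; rewrite fxy in fx.
    by rewrite (inj_f _ _ _ fx fy) ltxx.
  by apply/allP => x; rewrite mem_inc_seq.
- exact: inc_seq_sorted.
move=> y; rewrite mem_inc_seq; apply/mapP/codomfP => [[x]|[x fx]].
  by rewrite mem_inc_seq => /fnd_total_ext fx ->; exists x.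
exists x; last by rewrite /total_ext fx.
by rewrite mem_inc_seq -fndSome fx.
Qed.

Lemma card_codomf f : order_iso f -> #|` codomf f| = #|` domf f|.
Proof. by move=> f_iso; rewrite -!size_inc_seq -map_iso_sort // size_map. Qed.

(** On the increasing enumeration of the common domain, both maps list the
    increasing enumeration of the common range. *)
Lemma order_iso_eq f g : order_iso f -> order_iso g ->
  domf f = domf g -> codomf f = codomf g -> f = g.
Proof.
move=> f_iso g_iso eq_dom eq_cod; apply/fmapP => x.
have [xf|xNf] := boolP (x \in domf f); last first.
  by have xNg := xNf; rewrite eq_dom in xNg; rewrite !not_fnd.
have xg := xf; rewrite eq_dom in xg; rewrite !fnd_total_ext //; congr Some.
have : map (total_ext f) (inc_seq (domf f)) = map (total_ext g) (inc_seq (domf f)).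
  by rewrite {2}eq_dom !map_iso_sort // eq_cod.
by move/eq_in_map; apply; rewrite mem_inc_seq.
Qed.

Lemma index_inc_seq A x y : x \in A -> y \in A -> (x <= y)%O ->
  (index x (inc_seq A) <= index y (inc_seq A))%N.
Proof.
move=> xA yA le_xy; rewrite leqNgt; apply: contraTN le_xy => lt_yx.
rewrite -ltNge; apply: (sorted_ltn_index lt_trans (inc_seq_sorted A)) => //;
  by rewrite mem_inc_seq.
Qed.

(** Sends the i-th element of [A] to the i-th element of [B]; the default
    value of [nth] is never reached when the cardinalities agree. *)
Definition rank_map A B : {fmap L -> L} :=
  [fmap x : A => nth (val x) (inc_seq B) (index (val x) (inc_seq A))]%fmap.

Lemma fnd_rank_map A B x y : (rank_map A B).[? x]%fmap = Some y ->
  x \in A /\ y = nth x (inc_seq B) (index x (inc_seq A)).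
Proof. by case: fndP => // xA; rewrite ffunE => -[<-]. Qed.

Lemma index_rank_map A B x : #|` A| = #|` B| -> x \in A ->
  (index x (inc_seq A) < size (inc_seq B))%N.
Proof.
by move=> cAB xA; rewrite size_inc_seq -cAB -size_inc_seq index_mem mem_inc_seq.
Qed.

Lemma rank_map_iso A B : #|` A| = #|` B| -> order_iso (rank_map A B).
Proof.
move=> cAB; apply/order_isoP; split.
- move=> x y z /fnd_rank_map[xA ->] /fnd_rank_map[yA].
  rewrite (set_nth_default x y) ?index_rank_map // => /eqP.
  rewrite nth_uniq ?index_rank_map ?sort_uniq ?fset_uniq // => /eqP eq_i.
  by apply: (index_inj x _ _ eq_i); rewrite mem_inc_seq.
- move=> x y x' y' /fnd_rank_map[xA ->] /fnd_rank_map[yA ->] le_xy.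
  rewrite (set_nth_default x y) ?index_rank_map //.
  rewrite (lt_sorted_leq_nth _ (inc_seq_sorted B)) ?inE ?index_rank_map //.
  exact: index_inc_seq.
Qed.

Lemma codomf_rank_map A B : #|` A| = #|` B| -> codomf (rank_map A B) = B.
Proof.
move=> cAB; apply/eqP; rewrite eqEfcard card_codomf ?rank_map_iso //= cAB leqnn andbT.
apply/fsubsetP => y /codomfP[x /fnd_rank_map[xA ->]].
by rewrite -mem_inc_seq mem_nth ?index_rank_map.
Qed.

End FiniteChains.

(** * Elements as pairs of equipotent finite sets *)

Section OITheory.
Variables (d : Order.disp_t) (L : orderType d) (n : nat).
Implicit Types a b c e : OI L n.

Lemma OI_iso a : order_iso a.
Proof. by case: a => f /= /andP[]. Qed.

Lemma card_dom_OI a : (#|` domf a| <= n)%N.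
Proof. by case: a => f /= /andP[]. Qed.

Lemma card_codom_OI a : #|` codomf a| = #|` domf a|.
Proof. exact/card_codomf/OI_iso. Qed.

Lemma OI_inj a x y z : a.[? x]%fmap = Some z -> a.[? y]%fmap = Some z -> x = y.
Proof. by have /order_isoP[inj_a _] := OI_iso a; apply: inj_a. Qed.

Lemma OI_eq a b : domf a = domf b -> codomf a = codomf b -> a = b.
Proof. by move=> *; apply: val_inj; apply: order_iso_eq; rewrite ?OI_iso. Qed.

Lemma OI_exists (A B : {fset L}) : #|` A| = #|` B| -> (#|` A| <= n)%N ->
  exists c : OI L n, domf c = A /\ codomf c = B.
Proof.
move=> cAB cA; have c_in : in_OI n (rank_map A B) by rewrite /in_OI rank_map_iso.
by exists (MkOI c_in); rewrite [codomf _]codomf_rank_map.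
Qed.

Lemma fnd_OI_mul a b x :
  (a * b)%g.[? x]%fmap = obind (fun y => b.[? y]%fmap) a.[? x]%fmap.
Proof. exact: fnd_comp_fmap. Qed.

Lemma domf_mul_sub a b : (domf (a * b)%g `<=` domf a)%fset.
Proof.
by apply/fsubsetP => x; rewrite -!fndSome fnd_OI_mul; case: a.[? x]%fmap.
Qed.

Lemma codomf_mul_sub a b : (codomf (a * b)%g `<=` codomf b)%fset.
Proof.
apply/fsubsetP => z /codomfP[x]; rewrite fnd_OI_mul.
by case: a.[? x]%fmap => //= y bz; apply/codomfP; exists y.
Qed.

(** The multiplication rule (A, B)(B, C) = (A, C) for pairs of sets. *)
Lemma OI_mul_eq a b c :
  codomf a = domf b -> domf c = domf a -> codomf c = codomf b -> c = (a * b)%g.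
Proof.
move=> ab ca cb.
have dom_ab : domf (a * b)%g = domf a.
  apply/eqP; rewrite eqEfsubset domf_mul_sub; apply/fsubsetP => x xa.
  rewrite -fndSome fnd_OI_mul in_fnd /= fndSome -[_ \in _]/(_ \in domf b) -ab.
  exact: in_codomf.
apply: OI_eq; first by rewrite dom_ab.
(* The range of the product lies in that of [b] and has the same size. *)
apply/eqP; rewrite eq_sym eqEfcard cb codomf_mul_sub andTb.
by rewrite !card_codom_OI dom_ab -ab card_codom_OI.
Qed.

Lemma fnd_partial_id a x y : partial_id a -> a.[? x]%fmap = Some y -> y = x.
Proof. by move=> a_id; case: fndP => // xa [<-]; rewrite a_id. Qed.

(** If a is idempotent then a(a(x)) = a(x), hence a(x) = x by injectivity. *)
Lemma idempotent_partial_id a : idempotent_elt a <-> partial_id a.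
Proof.
split=> [aa x|a_id].
  have ax : a.[? val x]%fmap = Some (a x) by rewrite Some_fnd.
  have : (a * a)%g.[? val x]%fmap = Some (a x) by rewrite aa.
  by rewrite fnd_OI_mul ax => aax; apply: OI_inj aax ax.
apply/val_inj/fmapP => x; rewrite [LHS]fnd_OI_mul.
case ax: a.[? x]%fmap => [y|] //=.
by have := ax; rewrite (fnd_partial_id a_id ax).
Qed.

(** Composing on the right with a partial identity restricts the range; every
    restriction [a] of [b] arises so, since by injectivity the points that [b]
    sends into the range of [a] are exactly those of the domain of [a]. *)
Lemma natural_le_psub a b : natural_le a b <-> psub a b.
Proof.
split=> [[e [/idempotent_partial_id e_id ->]]|[sub_ab eq_ab]].
  split=> [|x]; first exact: domf_mul_sub.
  rewrite -fndSome fnd_OI_mul; case: b.[? x]%fmap => //= y.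
  by case ey: e.[? y]%fmap => [z|] // _; rewrite (fnd_partial_id e_id ey).
(* The idempotent is the identity of the range of [a]. *)
have [|e [dom_e cod_e]] := @OI_exists (codomf a) (codomf a) erefl.
  by rewrite card_codom_OI card_dom_OI.
have ee : idempotent_elt e.
  by apply/esym/OI_mul_eq; rewrite ?dom_e ?cod_e.
exists e; split=> //; apply/val_inj/fmapP => x; rewrite [RHS]fnd_OI_mul.
have e_id := (idempotent_partial_id e).1 ee.
have [xa|xNa] := boolP (x \in domf a).
  rewrite eq_ab //; case: fndP => //= ka.
  have : a.[ka]%fmap \in domf e by rewrite dom_e in_codomf.
  rewrite -fndSome; case ey: e.[? _]%fmap => [z|] // _.
  by rewrite (fnd_partial_id e_id ey).
rewrite not_fnd //; case bx: b.[? x]%fmap => [y|] //=.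
(* A preimage of b(x) under [a] would be another preimage under [b]. *)
have [ye|yNe] := boolP (y \in domf e); last by rewrite not_fnd.
rewrite dom_e in ye; have /codomfP[z az] := ye.
have za : z \in domf a by rewrite -fndSome az.
have bz : b.[? z]%fmap = Some y by rewrite eq_ab.
by rewrite (OI_inj bx bz) za in xNa.
Qed.

(** When the domains agree, the pair (ran b, ran a) exists and multiplies [b]
    on the right to [a]. *)
Lemma greenR_dom a b : greenR a b <-> domf a = domf b.
Proof.
have dom_sub a' b' : right_ideal b' a' -> (domf a' `<=` domf b')%fset.
  by move=> [[u|] _ <-] //=; apply: domf_mul_sub.
have mem_ideal a' b' : domf a' = domf b' -> right_ideal b' a'.
  move=> eq_dom.
  have [||u [dom_u cod_u]] := @OI_exists (codomf b') (codomf a').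
  - by rewrite !card_codom_OI eq_dom.
  - by rewrite card_codom_OI card_dom_OI.
  by exists (Some u) => //; apply/esym/OI_mul_eq.
split=> [/greenR_mem[ba ab]|eq_dom]; last by apply/greenR_mem; split; apply: mem_ideal.
by apply/eqP; rewrite eqEfsubset !dom_sub.
Qed.

(** When the ranges agree, the pair (dom a, dom b) exists and multiplies [b]
    on the left to [a]. *)
Lemma greenL_codom a b : greenL a b <-> codomf a = codomf b.
Proof.
have codom_sub a' b' : left_ideal b' a' -> (codomf a' `<=` codomf b')%fset.
  by move=> [[u|] _ <-] //=; apply: codomf_mul_sub.
have mem_ideal a' b' : codomf a' = codomf b' -> left_ideal b' a'.
  move=> eq_codom.
  have [||u [dom_u cod_u]] := @OI_exists (domf a') (domf b').
  - by rewrite -!card_codom_OI eq_codom.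
  - exact: card_dom_OI.
  by exists (Some u) => //; apply/esym/OI_mul_eq.
split=> [/greenL_mem[ba ab]|eq_codom]; last by apply/greenL_mem; split; apply: mem_ideal.
by apply/eqP; rewrite eqEfsubset !codom_sub.
Qed.

Lemma greenH_eq a b : greenH a b <-> a = b.
Proof.
split=> [[/greenL_codom eq_codom /greenR_dom eq_dom]|->]; first exact: OI_eq.
by [].
Qed.

(** The intermediate element must have the domain of [b] and the range of [a];
    these two sets are equipotent exactly when the ranks agree. *)
Lemma greenD_card a b : greenD a b <-> #|` domf a| = #|` domf b|.
Proof.
split=> [[s [/greenL_codom eq_codom /greenR_dom eq_dom]]|eq_card].
  by rewrite -eq_dom -!card_codom_OI eq_codom.
have [||s [dom_s cod_s]] := @OI_exists (domf b) (codomf a).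
- by rewrite card_codom_OI.
- exact: card_dom_OI.
by exists s; split; [apply/greenL_codom|apply/greenR_dom].
Qed.

(** Multiplying on the right shrinks the domain and on the left the range, and
    domain and range have the same cardinality. *)
Lemma two_sided_ideal_card a b :
  two_sided_ideal b a -> (#|` domf a| <= #|` domf b|)%N.
Proof.
move=> [u _ [v _ <-]]; apply: (@leq_trans #|` domf (mulS1 b v)|).
  rewrite -!card_codom_OI; case: u => [u|] //=.
  exact/fsubset_leq_card/codomf_mul_sub.
by case: v => [v|] //=; apply/fsubset_leq_card/domf_mul_sub.
Qed.

Lemma greenD_greenJ a b : greenD a b <-> greenJ a b.
Proof.
split=> [|/greenJ_mem[ba ab]]; first exact: greenD_J.
by apply/greenD_card/eqP; rewrite eqn_leq !two_sided_ideal_card.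
Qed.

End OITheory.

Theorem mainTheorem2 (d : Order.disp_t) (L : orderType d) (n : nat)
    (L_infinite : infinite_set [set: L]) (n_gt0 : (0 < n)%N) :
  (forall a : OI L n, a <> OI0 -> (idempotent_elt a <-> partial_id a)) /\
  (forall a b : OI L n, natural_le a b <-> psub a b) /\
  (forall a b : OI L n, greenR a b <-> domf a = domf b) /\
  (forall a b : OI L n, greenL a b <-> codomf a = codomf b) /\
  (forall a b : OI L n, greenH a b <-> a = b) /\
  (forall a b : OI L n, greenD a b <-> #|` domf a| = #|` domf b|) /\
  (forall a b : OI L n, greenD a b <-> greenJ a b).
Proof.
split; first by move=> a _; apply: idempotent_partial_id.
split; first exact: natural_le_psub.
split; first exact: greenR_dom.
split; first exact: greenL_codom.
split; first exact: greenH_eq.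
by split; [apply: greenD_card|apply: greenD_greenJ].
Qed.
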